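(* Let $f:Q\to\mathbb{R}$ be convex and subdifferentiable, let $g:Q\to\mathbb{R}$ be convex and satisfy $|g(x)-g(y)|\le M_g\|x-y\|$ for all $x,y\in Q$, and let $x_*$ be a solution of $\min\{f(x): x\in Q,\ g(x)\le 0\}$ with $d(x_* )\le\Theta_0^2$. Let $\varepsilon>0$ be a fixed number and let the stopping criterion $2\Theta_0^2/\varepsilon^2\le N$ of the Adaptive Mirror Descent algorithm described in the context be satisfied. Let $I$ be the set of indices of productive steps. Then $$\min_{k\in I} v_f(x^k,x_* )\le\varepsilon,\qquad \max_{k\in I} g(x^k)\le\varepsilon M_g .$$
   Context: $(E,\|\cdot\|)$ is a finite-dimensional normed space with dual $E^*$ and dual norm $\|y\|_*=\max\{\langle y,x\rangle:\|x\|\le1\}$; $Q\subset E$ is a closed convex set. $d:Q\to\mathbb{R}$ is a non-negative, continuously differentiable function that is $1$-strongly convex: $\langle\nabla d(x)-\nabla d(y),x-y\rangle\ge\|x-y\|^2$ for all $x,y\in Q$. The Bregman divergence is $V(x,y)=d(y)-d(x)-\langle\nabla d(x),y-x\rangle$, and for $x\in Q$, $p\in E^*$, $\mathrm{Mirr}_x(p)=\arg\min_{u\in Q}\{\langle p,u\rangle+V(x,u)\}$. $\nabla f(x)$, $\nabla g(x)$ denote subgradients of $f$, $g$ at $x$. Put $v_f(y,x_* )=\left\langle\frac{\nabla f(y)}{\|\nabla f(y)\|_*},y-x_*\right\rangle$ if $\nabla f(y)\ne0$, and $v_f(y,x_* )=0$ if $\nabla f(y)=0$. Adaptive Mirror Descent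 with accuracy $\varepsilon$: set $x^0=\arg\min_{x\in Q}d(x)$, $I=\emptyset$, $N=0$. Repeat: if $g(x^N)\le\varepsilon\|\nabla g(x^N)\|_*$ (productive step), put $h_N=\varepsilon/\|\nabla f(x^N)\|_*$, $x^{N+1}=\mathrm{Mirr}_{x^N}(h_N\nabla f(x^N))$ and add $N$ to $I$; otherwise (non-productive step), put $h_N=\varepsilon/\|\nabla g(x^N)\|_*$, $x^{N+1}=\mathrm{Mirr}_{x^N}(h_N\nabla g(x^N))$. Then increase $N$ by $1$. Stop as soon as $2\Theta_0^2/\varepsilon^2\le N$.
   Formalization: The second claim (max of g at most εM_g) is proved assuming the chosen subgradients satisfy ‖∇g(x)‖_* ≤ M_g on Q; the Lipschitz condition on Q alone does not give this at boundary points, and without it the claim can fail. *)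

(* Defs.v *)
From HB Require Import structures.
From mathcomp Require Export all_boot all_order all_algebra.
From mathcomp Require Export all_classical all_reals all_analysis.

Set Implicit Arguments.
Unset Strict Implicit.
Unset Printing Implicit Defensive.

Import Order.TTheory GRing.Theory Num.Theory.
Export numFieldNormedType.Exports.

Local Open Scope classical_set_scope.
Local Open Scope ring_scope.

(* A normed module that is also a [vectType], so that every linear functional
   is continuous and the topological dual E^* is ['Hom(E, R^o)]. *)
#[short(type="normedVectType")]
HB.structure Definition NormedVector (R : numFieldType) :=
  { E of NormedModule R E & Vector R E }.

Definition dual (R : realType) (E : normedVectType R) := 'Hom(E, R^o).

(* The set is nonempty and, by finite dimension, compact: the sup is a max. *)
Definition dual_norm (R : realType) (E : normedVectType R) (p : dual E) : R :=
  sup [set p x | x in [set x : E | `|x| <= 1]].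

Definition is_argmin (R : realType) (T : Type) (A : set T) (F : T -> R)
    (z : T) : Prop :=
  A z /\ forall u, A u -> F z <= F u.

Definition is_subgradient (R : realType) (E : normedVectType R) (Q : set E)
    (f : E -> R) (x : E) (p : dual E) : Prop :=
  forall y, Q y -> f x + p (y - x) <= f y.

(* Functions on [Q] are represented by functions on [E] of which only the
   values on [Q] matter. Accordingly [gd] is a Frechet derivative of [d]
   relative to [Q] (one-sided at the boundary), continuous on [Q]; [Q] may have
   empty interior. *)
Definition continuously_differentiable_on (R : realType)
    (E : normedVectType R) (Q : set E) (d : E -> R) (gd : E -> dual E) : Prop :=
  (forall x, Q x -> forall e : R, 0 < e ->
     \forall y \near within Q (nbhs x),
       `|d y - d x - gd x (y - x)| <= e * `|y - x|) /\
  (forall x, Q x ->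
     dual_norm (gd y - gd x) @[y --> within Q (nbhs x)] --> (0 : R)).

Definition strongly_convex1_on (R : realType) (E : normedVectType R)
    (Q : set E) (gd : E -> dual E) : Prop :=
  forall x y, Q x -> Q y -> `|x - y| ^+ 2 <= (gd x - gd y) (x - y).

Definition bregman (R : realType) (E : normedVectType R) (d : E -> R)
    (gd : E -> dual E) (x y : E) : R :=
  d y - d x - gd x (y - x).

Definition is_Mirr (R : realType) (E : normedVectType R) (Q : set E)
    (d : E -> R) (gd : E -> dual E) (x : E) (p : dual E) (z : E) : Prop :=
  is_argmin Q (fun u => p u + bregman d gd x u) z.

Definition v_sub (R : realType) (E : normedVectType R) (gf : E -> dual E)
    (y xs : E) : R :=
  if gf y == 0 then 0 else ((dual_norm (gf y))^-1 *: gf y) (y - xs).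

Section AdaptiveMirrorDescent.
Context (R : realType) (E : normedVectType R).
Variables (Q : set E) (d : E -> R) (gd : E -> dual E).
Variables (g : E -> R) (gf gg : E -> dual E) (eps Theta0 : R).

Definition productive (y : E) : bool := g y <= eps * dual_norm (gg y).

(* When the subgradient vanishes, [eps / 0] is a junk value, but the product
   is 0 whatever the step size is. *)
Definition AMD_direction (y : E) : dual E :=
  if productive y then (eps / dual_norm (gf y)) *: gf y
  else (eps / dual_norm (gg y)) *: gg y.

Definition AMD_stop (k : nat) : Prop := 2 * Theta0 ^+ 2 / eps ^+ 2 <= k%:R.

(* [x 0, ..., x N] are the points produced by a run that stops after [N] steps.
   The stopping test follows the step, so at least one step is made. *)
Record AMD_run (N : nat) (x : nat -> E) : Prop := {
  AMD_init : is_argmin Q d (x 0%N) ;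
  AMD_step : forall k, (k < N)%N ->
    is_Mirr Q d gd (x k) (AMD_direction (x k)) (x k.+1) ;
  AMD_nonempty : (0 < N)%N ;
  AMD_stopped : AMD_stop N ;
  AMD_not_before : forall k, (0 < k < N)%N -> ~ AMD_stop k
}.

End AdaptiveMirrorDescent.

(* Main.v *)
(* One mirror step with a direction p of dual norm at most eps satisfies
   <p, x^k - xs> <= eps^2/2 + V(x^k, xs) - V(x^(k+1), xs): combine the first
   order optimality condition of Mirr, the three-point identity for V, and
   V(x, z) >= |z - x|^2 / 2. On a non-productive step the left side exceeds eps^2
   because g(xs) <= 0; if all productive values of v_f exceeded eps, the same
   would hold on productive steps. Summation then gives
   N eps^2 / 2 < V(x^0, xs) <= d(xs) <= Theta0^2, against the stopping rule.
   In particular some step is productive. *)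
Require Import Defs.
From mathcomp Require Import ring lra.

Set Implicit Arguments.
Unset Strict Implicit.
Unset Printing Implicit Defensive.

Import Order.TTheory GRing.Theory Num.Theory.
Import VectorInternalTheory.
Local Open Scope classical_set_scope.
Local Open Scope ring_scope.

(* [p w] has type [R^o], which the arithmetic tactics do not identify with [R]. *)
Definition pairing (R : realType) (E : normedVectType R) (p : dual E) (w : E) : R :=
  p w.

Lemma pairingBl (R : realType) (E : normedVectType R) (p q : dual E) (w : E) :
  pairing (p - q) w = pairing p w - pairing q w.
Proof. by rewrite /pairing add_lfunE opp_lfunE. Qed.

Lemma pairingDl (R : realType) (E : normedVectType R) (p q : dual E) (w : E) :
  pairing (p + q) w = pairing p w + pairing q w.
Proof. by rewrite /pairing add_lfunE. Qed.

Lemma pairingZl (R : realType) (E : normedVectType R) (p : dual E) (t : R) (w : E) :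
  pairing (t *: p) w = t * pairing p w.
Proof. by rewrite /pairing scale_lfunE. Qed.

Lemma pairingBr (R : realType) (E : normedVectType R) (p : dual E) (u w : E) :
  pairing p (u - w) = pairing p u - pairing p w.
Proof. by rewrite /pairing linearB. Qed.

Lemma pairingDr (R : realType) (E : normedVectType R) (p : dual E) (u w : E) :
  pairing p (u + w) = pairing p u + pairing p w.
Proof. by rewrite /pairing linearD. Qed.

Lemma pairingZr (R : realType) (E : normedVectType R) (p : dual E) (t : R) (w : E) :
  pairing p (t *: w) = t * pairing p w.
Proof. by rewrite /pairing linearZ. Qed.

Lemma pairing0l (R : realType) (E : normedVectType R) (w : E) :
  pairing (0 : dual E) w = 0.
Proof. by rewrite /pairing zero_lfunE. Qed.

Lemma bregmanE (R : realType) (E : normedVectType R) (d : E -> R)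
    (gd : E -> dual E) (x y : E) :
  bregman d gd x y = d y - d x - (pairing (gd x) y - pairing (gd x) x).
Proof. by rewrite -pairingBr. Qed.

(** * Boundedness of linear functionals and the dual norm *)

Lemma linear_rV_norm_continuous (R : realType) (n : nat) (W : normedModType R)
    (p : {linear 'rV[R]_n -> W}) : continuous (fun v => `|p v|).
Proof.
have p_sum v : p v = \sum_i v 0 i *: p (delta_mx 0 i).
  by rewrite {1}(row_sum_delta v) linear_sum; apply: eq_bigr => i _; rewrite linearZ.
under [X in continuous X]eq_fun do rewrite p_sum.
move=> v; apply: continuous_comp; last exact: norm_continuous.
apply: continuous_big => [|i _ u]; first exact: add_continuous.
exact: continuousZr_tmp (@coord_continuous R 1 n 0 i u).
Qed.

(** Makes the supremum in [dual_norm] finite. The ratio of [|p w|] to [|w|] is read in coordinates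
    through [r2v], where the unit sphere is compact. *)
Lemma dual_bounded (R : realType) (E : normedVectType R) (p : dual E) :
  exists C : R, forall w, `|p w| <= C * `|w|.
Proof.
pose S := [set v : 'rV[R]_(dim E) | `|v| = 1].
have S_compact : compact S.
  apply: bounded_closed_compact.
    exists 1; split => // M M1 v /= ->; exact: ltW.
  apply: (@closed_comp _ _ (fun v : 'rV[R]_(dim E) => `|v|) [set 1]).
    by move=> v _; exact: norm_continuous.
  exact: closed_eq.
(* [F] is homogeneous of degree 0 and, on the compact unit sphere, continuous. *)
pose F (v : 'rV[R]_(dim E)) : R := `|p (r2v v)| / `|r2v v|.
have F_cont : {within S, continuous F}.
  apply: continuous_in_subspaceT => v; rewrite inE /S /= => v1.
  apply: (@continuousM R 'rV[R]_(dim E) (fun u => `|p (r2v u)|)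
    (fun u => `|r2v u|^-1) v).
    exact: (@linear_rV_norm_continuous _ _ R^o (p \o r2v : {linear _ -> _})).
  apply: (@continuousV R 'rV[R]_(dim E) (fun u => `|r2v u|) v);
    last exact: linear_rV_norm_continuous.
  rewrite normr_eq0; apply: contra_eq_neq v1.
  rewrite -(linear0 r2v) => /r2v_inj ->.
  by rewrite normr0 eq_sym oner_neq0.
have /compact_bounded[M [_ FM]] := continuous_compact F_cont S_compact.
(* [FM] bounds [F] only by numbers strictly above [M]. *)
exists (M + 1) => w.
have [->|w0] := eqVneq w 0; first by rewrite linear0 !normr0 mulr0.
have vw0 : 0 < `|v2r w|.
  by rewrite normr_gt0; apply: contra_neq w0; rewrite -(linear0 v2r) => /v2r_inj.
have : F (`|v2r w|^-1 *: v2r w) <= M + 1.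
  apply: le_trans (ler_norm _) _; apply: FM; first by rewrite ltrDl.
  exists (`|v2r w|^-1 *: v2r w) => //.
  by rewrite /S /= normrZ gtr0_norm ?invr_gt0 // mulVf // gt_eqF.
rewrite /F !linearZ /= v2rK !normrZ.
rewrite invfM mulrACA divff ?mul1r ?normr_eq0 ?invr_eq0 ?gt_eqF //.
by rewrite ler_pdivrMr // normr_gt0.
Qed.

Lemma dual_norm_ub (R : realType) (E : normedVectType R) (p : dual E) (w : E) :
  `|w| <= 1 -> p w <= dual_norm p.
Proof.
move=> w1; apply: ub_le_sup; last by exists w.
have [C pC] := dual_bounded p; exists `|C| => _ [v /= v1 <-].
apply: le_trans (ler_norm _) _; apply: le_trans (pC v) _.
by apply: le_trans (ler_norm _) _; rewrite normrM normr_id ler_piMr.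
Qed.

Lemma dual_norm_ge0 (R : realType) (E : normedVectType R) (p : dual E) :
  0 <= dual_norm p.
Proof. by rewrite -[leLHS](linear0 p) dual_norm_ub // normr0. Qed.

Lemma le_dual_norm (R : realType) (E : normedVectType R) (p : dual E) (w : E) :
  p w <= dual_norm p * `|w|.
Proof.
have [->|w0] := eqVneq w 0; first by rewrite linear0 normr0 mulr0.
have {}w0 : 0 < `|w| by rewrite normr_gt0.
rewrite -ler_pdivrMr // mulrC -[X in X <= _]/(`|w|^-1 *: (p w : R^o)) -linearZ.
by apply: dual_norm_ub; rewrite normrZ gtr0_norm ?invr_gt0 // mulVf // gt_eqF.
Qed.

Lemma dual_norm_gt0 (R : realType) (E : normedVectType R) (p : dual E) :
  p != 0 -> 0 < dual_norm p.
Proof.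
move=> p0; rewrite ltNge; apply/negP => pn0; move/eqP: p0; apply.
(* A nonpositive dual norm makes [p] nonpositive everywhere; the same at [- w] then forces
   [p = 0]. *)
have p_le0 w : p w <= 0.
  by apply: le_trans (le_dual_norm p w) _; rewrite mulr_le0_ge0.
apply/lfunP => w; rewrite lfunE /=; apply/eqP; rewrite eq_le p_le0 /=.
by rewrite -oppr_le0 -linearN p_le0.
Qed.

Lemma normalized_dual_le (R : realType) (E : normedVectType R) (p : dual E)
    (e : R) (w : E) :
  0 <= e -> pairing ((e / dual_norm p) *: p) w <= e * `|w|.
Proof.
move=> e0; rewrite pairingZl; have [->|p0] := eqVneq p 0.
  by rewrite pairing0l mulr0 mulr_ge0.
rewrite -mulrA ler_wpM2l //.
by rewrite mulrC ler_pdivrMr ?dual_norm_gt0 // mulrC le_dual_norm.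
Qed.

(** * Differentiation along segments of [Q] *)

Lemma convex_set_segment (R : realType) (E : lmodType R) (Q : set E) (x y : E)
    (t : R) :
  convex_set Q -> Q x -> Q y -> 0 <= t <= 1 -> Q (x + t *: (y - x)).
Proof.
move=> Qc Qx Qy /andP[t0 t1].
have := Qc y x (Itv01 t0 t1); rewrite !inE => /(_ Qy Qx).
by rewrite scalerBr addrCA -[X in X - _]scale1r -scalerBl.
Qed.

Section RelativeDerivative.
Context (R : realType) (E : normedVectType R).
Variables (Q : set E) (d : E -> R) (gd : E -> dual E).
Hypothesis Q_convex : convex_set Q.
Hypothesis d_C1 : continuously_differentiable_on Q d gd.

(** Chain rule with explicit remainder. The guard [0 <= t <= 1] keeps the moving point in [Q], where
    alone [gd] controls [d]; at the endpoints the statement is one-sided. *)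
Lemma derivative_along_segment (x y : E) (s e : R) :
  Q x -> Q y -> 0 <= s <= 1 -> 0 < e ->
  \forall t \near s, 0 <= t <= 1 ->
    `|d (x + t *: (y - x)) - d (x + s *: (y - x))
      - (t - s) * pairing (gd (x + s *: (y - x))) (y - x)| <= e * `|t - s|.
Proof.
move=> Qx Qy s01 e0; set v := y - x.
(* The remainder along the segment is proportional to [|t - s| * |v|]; the summand 1 avoids division
   by zero when [x = y]. *)
have e'0 : 0 < e / (1 + `|v|) by rewrite divr_gt0 // ltr_pwDl.
have v_cont : {for s, continuous (fun t : R => x + t *: v)}.
  apply: (@continuousD R E R (cst x) (fun t => t *: v)); first exact: cst_continuous.
  by apply: (@continuousZr_tmp R E R id v s); exact: cvg_id.
have [d_diff _] := d_C1.
have /d_diff/(_ _ e'0) := convex_set_segment Q_convex Qx Qy s01.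
move=> /v_cont v_near.
have {v_near} : nbhs s ((fun t => x + t *: v) @^-1` _) := v_near.
apply: filterS => t /= dt t01.
have := dt (convex_set_segment Q_convex Qx Qy t01).
rewrite opprD addrACA subrr add0r -scalerBl.
rewrite -/(pairing _ (_ *: v)) pairingZr normrZ.
move=> /le_trans; apply.
rewrite [`|t - s| * _]mulrC mulrA ler_wpM2r //.
by rewrite mulrAC ler_pdivrMr ?ltr_pwDl // ler_wpM2l ?lerDr // ltW.
Qed.

Lemma argmin_variational (q : dual E) (z u : E) :
  is_argmin Q (fun w => d w + pairing q w) z -> Q u ->
  0 <= pairing (gd z + q) (u - z).
Proof.
move=> [Qz z_min] Qu; rewrite leNgt; apply/negP; set s := (X in X < 0) => s0.
(* With an error of at most half the negative slope [s], the objective changes by at most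
   [t * s / 2 < 0], against minimality of [z]. *)
have e0 : 0 < - s / 2 by lra.
have zz : 0 <= (0 : R) <= 1 by rewrite lexx ler01.
have := derivative_along_segment Qz Qu zz e0.
rewrite scale0r addr0 => /nbhs_ballP[r /= r0 Hr].
pose t := Num.min 1 (r / 2).
have t0 : 0 < t by rewrite lt_min ltr01 divr_gt0.
have t1 : t <= 1 by rewrite ge_min lexx.
have tr : t < r by rewrite gt_min; apply/orP; right; lra.
have t01 : 0 <= t <= 1 by rewrite ltW.
have := Hr t; rewrite /ball /= sub0r normrN gtr0_norm // => /(_ tr t01).
rewrite subr0 (gtr0_norm t0) ler_norml => /andP[_].
have := z_min _ (convex_set_segment Q_convex Qz Qu t01).
rewrite (pairingDr q z) pairingZr; move: s0; rewrite /s pairingDl.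
by move: (pairing (gd z) _) (pairing q (u - z)) => a b; nra.
Qed.

(** The mean value theorem is applied to [d] along the segment, with its linear part and the
    quadratic [t ^+ 2 / 2 * D] subtracted, so that strong monotonicity becomes the sign of one
    derivative. *)
Lemma bregman_strong (x y : E) : strongly_convex1_on Q gd -> Q x -> Q y ->
  `|y - x| ^+ 2 / 2 <= bregman d gd x y.
Proof.
move=> d_strong Qx Qy; set v := y - x; set D : R := `|v| ^+ 2.
have D0 : 0 <= D by exact: sqr_ge0.
pose pt (t : R) := x + t *: v.
pose psi t : R := pairing (gd (pt t)) v - pairing (gd x) v - t * D.
(* [F 0 = d x], [F 1 = d y - <gd x, v> - D / 2] and [F' = psi >= 0]. *)
pose F t := d (pt t) - t * pairing (gd x) v - t ^+ 2 / 2 * D.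
have Fnear (s e : R) : 0 <= s <= 1 -> 0 < e -> \forall t \near s,
    0 <= t <= 1 -> `|F t - F s - (t - s) * psi s| <= e * `|t - s|.
  move=> s01 e0.
  have e20 : 0 < e / 2 by rewrite divr_gt0.
  (* Within this radius the quadratic remainder [(t - s) ^+ 2 / 2 * D] costs at most
     [e / 2 * |t - s|]. *)
  have De0 : 0 < e / (1 + D).
    by rewrite divr_gt0 // ltr_pwDl // sqr_ge0.
  have /nbhs_ballP[r /= r0 Hr] := derivative_along_segment Qx Qy s01 e20.
  apply/nbhs_ballP; exists (Num.min r (e / (1 + D))); rewrite /= ?lt_min ?r0 //.
  move=> t /=; rewrite /ball /= lt_min => /andP[tr te] t01.
  have := Hr t tr t01; rewrite -/v -/(pt _) -/(pt _).
  have -> : F t - F s - (t - s) * psi s = d (pt t) - d (pt s)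
      - (t - s) * pairing (gd (pt s)) v - (t - s) ^+ 2 / 2 * D.
    by rewrite /F /psi; field.
  move=> H; apply: le_trans (ler_normB _ _) _.
  have -> : e * `|t - s| = e / 2 * `|t - s| + e / 2 * `|t - s| by field.
  apply: lerD => //.
  have sq_ge0 : 0 <= (t - s) ^+ 2 / 2 * D.
    by apply: mulr_ge0 => //; apply: divr_ge0 => //; exact: sqr_ge0.
  rewrite (ger0_norm sq_ge0).
  have -> : (t - s) ^+ 2 = `|t - s| ^+ 2 by rewrite real_normK ?num_real.
  have : `|t - s| * (1 + D) <= e.
    by rewrite -ler_pdivlMr ?ltr_pwDl // distrC ltW.
  by have := normr_ge0 (t - s); nra.
have F_cont : {within `[0, 1], continuous F}.
  apply/subspace_continuousP => s /=; rewrite in_itv /= => s01.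
  apply/cvgrPdist_le => e e0.
  have C0 : 0 < 1 + `|psi s| by rewrite ltr_pwDl.
  rewrite near_withinE; near=> t; rewrite /= in_itv /= => t01.
  have : `|F t - F s - (t - s) * psi s| <= 1 * `|t - s|.
    by move: t01; near: t; exact: Fnear.
  have : `|t - s| <= e / (1 + `|psi s|).
    near: t; apply/nbhs_ballP; exists (e / (1 + `|psi s|)); first exact: divr_gt0.
    by move=> t /=; rewrite /ball /= distrC => /ltW.
  rewrite ler_pdivlMr // => te Ft.
  rewrite distrC -[F t - F s](subrK ((t - s) * psi s)).
  apply: le_trans (ler_normD _ _) _; rewrite normrM; apply: le_trans te.
  by lra.
have F_derive (s : R) : s \in `]0, 1[%R -> is_derive s 1 F (psi s).
  rewrite in_itv /= => /andP[s0 s1].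
  have s01 : 0 <= s <= 1 by rewrite !ltW.
  suff H : h^-1 *: (F (h *: 1 + s) - F s) @[h --> 0^'] --> psi s.
    by apply: DeriveDef; [apply: cvgP H | apply: cvg_lim H].
  apply/cvgrPdist_le => e e0.
  near=> h.
  have h0 : h != 0 by near: h; exact: nbhs_dnbhs_neq.
  (* At an interior [s] the guard of [Fnear] holds for all small [h], so the derivative is
     two-sided. *)
  have hs : 0 <= h + s <= 1.
    near: h; apply: nbhs_dnbhs; apply/nbhs_ballP.
    exists (Num.min s (1 - s)); rewrite /= ?lt_min ?subr_gt0 ?s0 // => h.
    rewrite /ball /= sub0r normrN lt_min !ltr_norml => /andP[/andP[? ?] /andP[? ?]].
    by apply/andP; split; lra.
  have : `|F (h + s) - F s - (h + s - s) * psi s| <= e * `|h + s - s|.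
    move: hs; near: h; apply: nbhs_dnbhs.
    have : \forall t \near 0 + s, 0 <= t <= 1 ->
      `|F t - F s - (t - s) * psi s| <= e * `|t - s| by rewrite add0r; exact: Fnear.
    have shift_cont : {for (0 : R), continuous (fun h : R => h + s)}.
      by apply: (@continuousD R R^o R id (cst s)); [exact: cvg_id | exact: cvg_cst].
    by move=> /shift_cont.
  rewrite addrK -ler_pdivrMr ?normr_gt0 // -normfV -normrM.
  congr (_ <= _); rewrite distrC; congr (`|_|).
  by rewrite -[h%:A]/(h * 1) mulr1 -[_ *: _]/(h^-1 * _); field.
have [c] := MVT ltr01 F_derive F_cont.
rewrite in_itv /= subr0 mulr1 => /andP[c0 c1].
have c01 : 0 <= c <= 1 by rewrite !ltW.
(* Strong monotonicity between [pt c] and [x] gives [c * psi c >= 0], and [c > 0]. *)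
have psi_ge0 : 0 <= psi c.
  have := d_strong _ _ (convex_set_segment Q_convex Qx Qy c01) Qx.
  have ptB : pt c - x = c *: v by rewrite /pt addrC addKr.
  rewrite -/v -/(pt c) ptB -/(pairing _ _) pairingBl !pairingZr normrZ.
  by rewrite (gtr0_norm c0) exprMn -/D /psi; nra.
have pt0 : pt 0 = x by rewrite /pt scale0r addr0.
have pt1 : pt 1 = y by rewrite /pt scale1r addrC subrK.
rewrite /F pt0 pt1 => Fc.
by rewrite /bregman -/v -/(pairing _ _); lra.
Unshelve. all: by end_near. Qed.
End RelativeDerivative.

(** * The mirror step and bounds on the Bregman divergence *)

Section MirrorStep.
Context (R : realType) (E : normedVectType R).
Variables (Q : set E) (d : E -> R) (gd : E -> dual E).
Hypothesis Q_convex : convex_set Q.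
Hypothesis d_C1 : continuously_differentiable_on Q d gd.
Hypothesis d_strong : strongly_convex1_on Q gd.

Lemma mirror_step (p : dual E) (K : R) (x z u : E) :
  (forall w, pairing p w <= K * `|w|) -> Q x -> Q u -> is_Mirr Q d gd x p z ->
  pairing p (x - u) <= K ^+ 2 / 2 + bregman d gd x u - bregman d gd z u.
Proof.
move=> pK Qx Qu [Qz z_min].
(* Up to a constant, the objective of [is_Mirr] is [d] plus the functional [p - gd x]. *)
have z_argmin : is_argmin Q (fun w => d w + pairing (p - gd x) w) z.
  split=> // w Qw; rewrite !pairingBl.
  have : pairing p z + bregman d gd x z <= pairing p w + bregman d gd x w.
    exact: z_min.
  by rewrite !bregmanE; lra.
have := argmin_variational Q_convex d_C1 z_argmin Qu.
rewrite pairingDl pairingBl !pairingBr.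
have := bregman_strong Q_convex d_C1 d_strong Qx Qz.
have := pK (x - z).
rewrite !bregmanE pairingBr distrC.
(* Young's inequality: [K * |z - x|] is at most [K ^+ 2 / 2] plus the quadratic that
   [bregman_strong] absorbs. *)
have : 0 <= (K - `|z - x|) ^+ 2 by exact: sqr_ge0.
move: (pairing p u) => pu.
by move=> *; lra.
Qed.

Lemma bregman_argmin_le (x u : E) :
  is_argmin Q d x -> Q u -> bregman d gd x u <= d u - d x.
Proof.
move=> [Qx x_min] Qu.
have x_argmin : is_argmin Q (fun w => d w + pairing (0 : dual E) w) x.
  by split=> // w Qw; rewrite !pairing0l !addr0 x_min.
have := argmin_variational Q_convex d_C1 x_argmin Qu.
by rewrite addr0 /bregman lerBlDr lerDl.
Qed.

Lemma bregman_ge0 (x u : E) : Q x -> Q u -> 0 <= bregman d gd x u.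
Proof.
move=> Qx Qu; apply: le_trans (bregman_strong Q_convex d_C1 d_strong Qx Qu).
by rewrite divr_ge0 // sqr_ge0.
Qed.

End MirrorStep.

(* The norm bound on the subgradients of g used for the second claim does not
   follow from the Lipschitz condition at boundary points of Q. *)
Theorem theorem3p2 (R : realType) (E : normedVectType R) (Q : set E)
    (d : E -> R) (gd : E -> dual E) (f g : E -> R) (gf gg : E -> dual E)
    (Mg Theta0 eps : R) (xs : E) (N : nat) (x : nat -> E)
    (Q_closed : closed Q) (Q_convex : convex_set Q)
    (d_ge0 : forall y, Q y -> 0 <= d y)
    (d_C1 : continuously_differentiable_on Q d gd)
    (d_strong : strongly_convex1_on Q gd)
    (f_convex : convex_function Q f)
    (f_sub : forall y, Q y -> is_subgradient Q f y (gf y))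
    (g_convex : convex_function Q g)
    (g_sub : forall y, Q y -> is_subgradient Q g y (gg y))
    (g_lip : forall y z, Q y -> Q z -> `|g y - g z| <= Mg * `|y - z|)
    (xs_sol : is_argmin (Q `&` [set y | g y <= 0]) f xs)
    (xs_Theta0 : d xs <= Theta0 ^+ 2)
    (eps_gt0 : 0 < eps)
    (run : AMD_run Q d gd g gf gg eps Theta0 N x) :
  (\big[mine/+oo]_(k < N | productive g gg eps (x k))
      (v_sub gf (x k) xs)%:E <= eps%:E)%E
  /\
  ((forall y, Q y -> dual_norm (gg y) <= Mg) ->
   (\big[maxe/-oo]_(k < N | productive g gg eps (x k))
      (g (x k))%:E <= (eps * Mg)%:E)%E).
Proof.
case: run => x0_min x_step N0 stop _; case: xs_sol => -[Qxs gxs] _.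
have Qx k : (k <= N)%N -> Q (x k).
  by case: k => [_|k kN]; [case: x0_min | case: (x_step k kN)].
split; last first.
  move=> gg_le; apply/bigmax_leP; split=> [|k k_prod]; first exact: leNye.
  rewrite lee_fin; apply: le_trans k_prod _.
  rewrite ler_pM2l //; apply: gg_le; exact/Qx/ltnW.
(* An empty minimum is [+oo], so the negated claim also covers a run without productive steps. *)
rewrite leNgt; apply/negP => lt_min.
have v_gt k : (k < N)%N -> productive g gg eps (x k) ->
    eps < v_sub gf (x k) xs.
  move=> kN k_prod; rewrite -lte_fin; apply: lt_le_trans lt_min _.
  exact: (@bigmin_le_cond _ _ _ _ (Ordinal kN)).
pose B k := bregman d gd (x k) xs.
have progress k : (k < N)%N -> eps ^+ 2 / 2 + B k.+1 < B k.
  move=> kN; have Qxk := Qx _ (ltnW kN).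
  have := mirror_step Q_convex d_C1 d_strong (K := eps) _ Qxk Qxs (x_step k kN).
  set p := AMD_direction _ _ _ _ _; rewrite -/(B k) -/(B k.+1).
  have p_le w : pairing p w <= eps * `|w|.
    by rewrite /p /AMD_direction; case: ifP => _; exact/normalized_dual_le/ltW.
  move=> /(_ p_le).
  suff : eps ^+ 2 < pairing p (x k - xs) by lra.
  rewrite /p /AMD_direction; case: ifP => [k_prod|/negbT].
    have := v_gt k kN k_prod; rewrite /v_sub.
    case: eqP => [_ /(lt_trans eps_gt0)|_]; first by rewrite ltxx.
    by rewrite -/(pairing _ _) !pairingZl expr2 -mulrA ltr_pM2l.
  rewrite /productive -ltNge pairingZl => g_gt.
  have := g_sub _ Qxk _ Qxs.
  rewrite -/(pairing _ _) => g_xs.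
  (* A zero subgradient would give [g (x k) <= g xs <= 0], making the step productive. *)
  have gn0 : 0 < dual_norm (gg (x k)).
    apply: dual_norm_gt0; apply/eqP => gg0.
    move: g_xs g_gt; rewrite gg0 pairing0l addr0 => g_le.
    have := dual_norm_ge0 (0 : dual E).
    by move: gxs => /= gxs /(mulr_ge0 (ltW eps_gt0)); lra.
  rewrite expr2 -mulrA ltr_pM2l // ltr_pdivlMl // mulrC.
  by move: gxs g_xs; rewrite /= !pairingBr; lra.
(* Indexed from one step on, since the inequality is strict; [0 < N] then allows [n = N.-1]. *)
have descent n : (n < N)%N -> n.+1%:R * (eps ^+ 2 / 2) + B n.+1 < B 0%N.
  elim: n => [|n IH] nN; first by rewrite mul1r progress.
  have := IH (ltnW nN); have := progress _ nN.
  by rewrite -[n.+2%:R]natr1; lra.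
have := descent N.-1; rewrite prednK // leqnn => /(_ isT).
have := bregman_ge0 Q_convex d_C1 d_strong (Qx _ (leqnn N)) Qxs.
have := bregman_argmin_le Q_convex d_C1 x0_min Qxs.
have := d_ge0 _ (Qx 0%N isT).
move: stop; rewrite /AMD_stop ler_pdivrMr ?exprn_gt0 // -/(B _) -/(B _).
by lra.
Qed.
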